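(* Let $n$ be a positive integer and $T_1,\ldots,T_n\in B(\mathcal H)$. Then $w(T_1,\ldots,T_n)\le1$ if and only if there exist a Hilbert space $\mathcal K\supseteq\mathcal H$ and isometries $V_1,\ldots,V_n\in B(\mathcal K)$ with orthogonal ranges such that $$T_\sigma=2P_{\mathcal H}V_\sigma|_{\mathcal H}\quad\text{for any }\sigma\in\mathbb F_n^+\setminus\{g_0\}.$$
   Context: $\mathcal H$ is a complex Hilbert space; $P_{\mathcal H}$ is the orthogonal projection of $\mathcal K$ onto $\mathcal H$. $\mathbb F_n^+$ is the unital free semigroup on generators $g_1,\ldots,g_n$ with identity $g_0$; for $\sigma=g_{i_1}\cdots g_{i_k}$, $T_\sigma=T_{i_1}\cdots T_{i_k}$ (similarly $V_\sigma$). Joint numerical radius: $w(T_1,\ldots,T_n):=\sup\left|\sum_{\alpha\in\mathbb F_n^+}\sum_{j=1}^n\langle h_\alpha,T_jh_{g_j\alpha}\rangle\right|$, the supremum being over all families $\{h_\alpha\}_{\alpha\in\mathbb F_n^+}\subset\mathcal H$ with $\sum_\alpha\|h_\alpha\|^2=1$. *)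

(* Defs.v *)
From HB Require Import structures.
From mathcomp Require Import all_boot all_order all_algebra.
From mathcomp Require Import complex sesquilinear.
From mathcomp Require Import all_classical all_reals all_analysis.
From mathcomp Require Import showcase.summability.

Set Implicit Arguments.
Unset Strict Implicit.
Unset Printing Implicit Defensive.
Import Order.TTheory GRing.Theory Num.Theory.
Import numFieldNormedType.Exports.

Local Open Scope classical_set_scope.
Local Open Scope complex_scope.
Local Open Scope ring_scope.

(* The inner product is linear in its first argument and conjugate-linear in
   the second one. *)
HB.mixin Record CompleteNormedModule_isHilbert (R : realType) H
    of CompleteNormedModule R[i] H := {
  inner : {dot H for (@Num.conj R[i])};
  inner_norm : forall x : H, `|x| ^+ 2 = inner x x
}.

#[short(type="hilbertType")]
HB.structure Definition Hilbert (R : realType) :=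
  {H of CompleteNormedModule_isHilbert R H & CompleteNormedModule R[i] H}.

(* The free semigroup on n generators is [seq 'I_n], with [::] as g_0 and
   concatenation as product, so that g_j alpha is [j :: alpha]. *)
Definition word_op (X : Type) (n : nat) (T : 'I_n -> X -> X)
    (s : seq 'I_n) : X -> X :=
  foldr (fun j f => T j \o f) idfun s.

(* Norms take their values in [R[i]], hence the real parts. *)
Definition unit_family (R : realType) (H : hilbertType R) (n : nat) :
    set (seq 'I_n -> H) :=
  [set h | (\esum_(a in [set: seq 'I_n]) (complex.Re `|h a| ^+ 2)%:E = 1)%E].

(* [sum] is the limit over the directed set of finite subsets; for bounded
   [T j] and h in [unit_family] it exists, by the Cauchy-Schwarz inequality. *)
Definition joint_form (R : realType) (H : hilbertType R) (n : nat)
    (T : 'I_n -> H -> H) (h : seq 'I_n -> H) : R[i] :=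
  sum (fun a => \sum_(j < n) inner (h a) (T j (h (j :: a))) : R[i]^o).

(* On the zero space there is no unit family and the supremum is -oo. *)
Definition joint_numerical_radius (R : realType) (H : hilbertType R) (n : nat)
    (T : 'I_n -> H -> H) : \bar R :=
  ereal_sup [set (complex.Re `|joint_form T h|)%:E | h in @unit_family R H n].

Definition orthogonal_ranges (R : realType) (K : hilbertType R) (n : nat)
    (V : 'I_n -> K -> K) : Prop :=
  forall i j : 'I_n, i != j -> forall x y : K, inner (V i x) (V j y) = 0.

Definition orthogonal_projection (R : realType) (K : hilbertType R)
    (A : set K) (P : K -> K) : Prop :=
  forall x, A (P x) /\ forall y, A y -> inner (x - P x) y = 0.

(* Main.v *)
Require Import Defs.
From HB Require Import structures.
From mathcomp Require Import all_boot all_order all_algebra finmap.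
From mathcomp Require Import complex sesquilinear.
From mathcomp Require Import all_classical all_reals all_analysis.
From mathcomp Require Import showcase.summability ring.

(* Reverse all words, and put [(A h)_a = sum_j T_j h_(a g_j)] for a finitely
   supported family [h]. The bound [w(T) <= 1] says that
   [|<A h, h>| <= |h|^2] ([backward] is [A], and [dissipative] is this bound).
   Let [D h = h - A h] and [Q(h, h') = (<D h, h'> + <h, D h'>) / 2], so that
   [Q(h, h) = |h|^2 - Re <A h, h>]. If [w(T) <= 1], then [Q >= 0]. Let [V_i] be
   the operator on families that puts [h_a] in position [g_i a] and
   [T_i h_(g_0)] in position [g_0]. Then [D V_i = S_i D] with [S_i] the shift,
   hence [Q(V_i h, V_l h') = delta_il Q(h, h')]. For [x] in position [g_0] and
   [s <> g_0], the family [V_s x] has [T_s x] in position [g_0], and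
   [Q(V_s x, y) = <T_s x, y> / 2]. So the completion of [Q] is a dilation.
   Conversely, in a dilation the vector [sum_a V_a (D h)_a] has squared norm
   [Q(h, h)], so [Re <A h, h> <= |h|^2]; multiplying [h_a] by [u^|a|] with
   [|u| = 1] multiplies [<A h, h>] by [u], whence [|<A h, h>| <= |h|^2]. *)

Set Implicit Arguments.
Unset Strict Implicit.
Unset Printing Implicit Defensive.
Import Order.TTheory GRing.Theory Num.Theory.
Import numFieldNormedType.Exports.

Local Open Scope classical_set_scope.
Local Open Scope complex_scope.
Local Open Scope ring_scope.

(** * Semi-inner products and their completion *)

(** Definiteness is not demanded: vectors of square zero are identified in the completion. *)
Record semi_inner (C : numClosedFieldType) (U : lmodType C) := SemiInner {
  semi_form :> {hermitian U for false & (@Num.conj C)};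
  semi_form_ge0 : forall u, 0 <= semi_form u u }.

Section SemiInnerTheory.
Variables (C : numClosedFieldType) (U : lmodType C) (q : semi_inner U).

Lemma semi_formC u v : q u v = (q v u)^*.
Proof. by rewrite hermC mul1r. Qed.

Lemma semi_formZl a u v : q (a *: u) v = a * q u v.
Proof. exact: linearZl_LR. Qed.

Lemma semi_formZr a u v : q u (a *: v) = a^* * q u v.
Proof. exact: linearZr_LR. Qed.

Lemma semi_formZ a u : q (a *: u) (a *: u) = `|a| ^+ 2 * q u u.
Proof. by rewrite semi_formZl semi_formZr mulrA normCK. Qed.

Lemma semi_formD u v :
  q (u + v) (u + v) = q u u + q v v + (q u v + (q u v)^*).
Proof. by rewrite hnormD mul1r. Qed.

Lemma semi_formB u v :
  q (u - v) (u - v) = q u u + q v v - (q u v + (q u v)^*).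
Proof. by rewrite hnormB mul1r. Qed.

(** The square of [t *: u - (s * q u v) *: v] is nonnegative; [t = q v v], [s = 1] gives the
    inequality unless [q v v = 0]. In that case, possible for a degenerate form, [q u v] has to
    vanish. *)
Lemma semi_CauchySchwarz u v : `|q u v| ^+ 2 <= q u u * q v v.
Proof.
have a0 := semi_form_ge0 q u; have b0 := semi_form_ge0 q v.
have expand (t s : C) : 0 <= t -> 0 <= s ->
    q (t *: u - (s * q u v) *: v) (t *: u - (s * q u v) *: v) =
    t ^+ 2 * q u u + s ^+ 2 * `|q u v| ^+ 2 * q v v - 2 * t * s * `|q u v| ^+ 2.
  move=> t0 s0; have tr := conj_Creal (ger0_real t0).
  have sr := conj_Creal (ger0_real s0).
  rewrite semi_formB !semi_formZ semi_formZl semi_formZr.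
  rewrite normrM (ger0_norm t0) (ger0_norm s0) !rmorphM /= !conjCK tr sr.
  by rewrite exprMn normCK; ring.
have [b1|] := boolP (q v v == 0); last first.
  move=> bn0; have bp : 0 < q v v by rewrite lt_def bn0.
  have := semi_form_ge0 q (q v v *: u - (1 * q u v) *: v).
  rewrite expand // => h.
  rewrite -(ler_pM2l bp) -subr_ge0; apply: le_trans h _.
  by rewrite le_eqVlt; apply/orP; left; apply/eqP; ring.
have [-> |c0] := eqVneq (q u v) 0.
  by rewrite normr0 expr0n /= mulr_ge0.
(* If [q v v = 0], the vector below has square [- q u u - 2 < 0]. *)
have cp : 0 < `|q u v| ^+ 2 by rewrite exprn_gt0 // normr_gt0.
have := semi_form_ge0 q (1 *: u - ((q u u + 1) / `|q u v| ^+ 2 * q u v) *: v).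
rewrite expand //; last by rewrite divr_ge0 ?addr_ge0 // ltW.
rewrite (eqP b1) mulr0 addr0 expr1n mul1r mulr1 -[2 * _ * _]mulrA.
rewrite divfK ?gt_eqF //.
have -> : q u u - 2 * (q u u + 1) = - (q u u + 2) by ring.
rewrite oppr_ge0 => h.
have : 0 < q u u + 2 by rewrite ltr_wpDl.
by move=> /(le_lt_trans h); rewrite ltxx.
Qed.

Definition semi_norm u := sqrtC (q u u).

Lemma semi_norm_ge0 u : 0 <= semi_norm u.
Proof. by rewrite sqrtC_ge0 semi_form_ge0. Qed.

Lemma semi_normK u : semi_norm u ^+ 2 = q u u.
Proof. exact: sqrtCK. Qed.

Lemma semi_CauchySchwarz_sqrt u v : `|q u v| <= semi_norm u * semi_norm v.
Proof.
rewrite -ler_sqr ?nnegrE ?mulr_ge0 ?semi_norm_ge0 //.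
by rewrite exprMn !semi_normK semi_CauchySchwarz.
Qed.

Lemma semi_normD u v : semi_norm (u + v) <= semi_norm u + semi_norm v.
Proof.
rewrite -ler_sqr ?nnegrE ?addr_ge0 ?semi_norm_ge0 //.
rewrite sqrrD !semi_normK semi_formD [leRHS]addrAC lerD2l.
apply: le_trans (real_ler_norm _) _.
  by apply/CrealP; rewrite rmorphD /= conjCK addrC.
rewrite (le_trans (ler_normD _ _)) // norm_conjC -mulr2n.
by rewrite lerMn2r /= semi_CauchySchwarz_sqrt.
Qed.

Lemma semi_normZ a u : semi_norm (a *: u) = `|a| * semi_norm u.
Proof.
rewrite /semi_norm semi_formZ sqrtCM ?nnegrE ?exprn_ge0 ?semi_form_ge0 //.
by rewrite sqrCK.
Qed.

Lemma semi_norm0 : semi_norm 0 = 0.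
Proof. by rewrite /semi_norm linear0l sqrtC0. Qed.

End SemiInnerTheory.

(** * Limits of complex sequences *)

Lemma conjC_continuous (C : numClosedFieldType) :
  continuous (Num.conj : C^o -> C^o).
Proof.
move=> z A /nbhs_ballP[e e0 eA]; apply/nbhs_ballP; exists e => // w zw.
by apply: eA; move: zw; rewrite /ball /= /ball_ -rmorphB norm_conjC.
Qed.

Lemma cvg_conjC (C : numClosedFieldType) (u : nat -> C^o) (l : C^o) :
  u @ \oo --> l -> (fun k => (u k)^* : C^o) @ \oo --> (l^* : C^o).
Proof. by move=> ul; apply: cvg_comp ul _; exact: conjC_continuous. Qed.

Lemma cvg_seq_unique (C : numFieldType) (u : nat -> C^o) (a b : C^o) :
  u @ \oo --> a -> u @ \oo --> b -> a = b.
Proof. by apply: cvg_unique. Qed.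

Lemma cvg_seq_ge0 (C : numFieldType) (u : nat -> C^o) (l : C^o) :
  u @ \oo --> l -> (\forall k \near \oo, 0 <= u k) -> 0 <= l.
Proof.
(* Nonnegativity includes being real here, so the limit is shown to equal its own norm. *)
move=> ul u0; suff <- : `|l| = l by [].
apply: (@cvg_seq_unique _ (fun k => `|u k|)); first exact: cvg_norm.
apply: cvg_trans ul; apply: near_eq_cvg; near=> k; apply/esym/ger0_norm.
by near: k; exact: u0.
Unshelve. all: by end_near. Qed.

Section ComplexLimits.
Variable R : realType.
Local Notation C := R[i].

(** Real and imaginary parts do not increase the norm, so both are Cauchy and converge in [R]. *)
Lemma cauchy_seqC (u : nat -> C^o) :
  (forall e : C, 0 < e -> exists N, forall k l, (N <= k)%N -> (N <= l)%N ->
     `|u k - u l| < e) -> cvgn u.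
Proof.
move=> uc.
have part (f : {additive C -> R}) : (forall z, `|f z|%:C <= `|z|) ->
    cvgn (fun k => f (u k)).
  move=> fle; apply/cauchy_cvgP/cauchy_ballP => e e0; near_simpl.
  have [|N uN] := uc e%:C; first by rewrite ltcR.
  exists ([set k | (N <= k)%N], [set k | (N <= k)%N]).
    by split; exists N.
  move=> [k l] [/= Nk Nl]; rewrite /ball /= -raddfB -ltcR.
  by apply: le_lt_trans (fle _) (uN _ _ _ _).
have Rec := part (@complex.Re R) (@normc_ge_Re R).
have normi : `|'i%C| = 1 :> C.
  by rewrite normc_def /= expr0n expr1n add0r sqrtr1.
have Imle (z : C) : `|complex.Im z|%:C <= `|z|.
  have := @normc_ge_Re R (z * 'i%C).
  by rewrite ReiNIm normrN normrM normi mulr1.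
have Imc := part (@complex.Im R) Imle.
apply/cvg_ex; exists (lim (complex.Re (u k) @[k --> \oo]) +i*
                      lim (complex.Im (u k) @[k --> \oo])).
apply/cvgrPdist_lt => e e0.
have [a ae] : exists a : R, e = a%:C.
  by exists (complex.Re e); rewrite RRe_real // gtr0_real.
move: e0; rewrite {}ae => e0.
have e20 : 0 < a / 2 by rewrite divr_gt0 // -ltcR.
move/cvgrPdist_lt : Rec => /(_ _ e20) Rec.
move/cvgrPdist_lt : Imc => /(_ _ e20) Imc.
near=> k.
rewrite [X in `|X|]complexE (le_lt_trans (ler_normD _ _)) //.
rewrite normrM normi mul1r.
rewrite [in ltRHS](splitr a) rmorphD /=.
have normR (r : R) : `|r%:C| = `|r|%:C :> C.
  by rewrite normc_def /= expr0n addr0 sqrtr_sqr.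
rewrite (raddfB (@complex.Re R)) (raddfB (@complex.Im R)) /=.
by rewrite ltrD // normR ltcR; near: k.

Unshelve. all: by end_near. Qed.

End ComplexLimits.

(** * Cauchy sequences and the functionals that they define *)

Section WeakLimits.
Variables (R : realType) (U : lmodType R[i]) (q : semi_inner U).
Local Notation C := R[i].
Local Notation "''N' u" := (semi_norm q u) (at level 10, u at level 8).

Definition semi_cauchy (x : nat -> U) := forall e : C, 0 < e ->
  exists N, forall k l, (N <= k)%N -> (N <= l)%N -> 'N (x k - x l) < e.

(** As [x] is Cauchy, it converges in norm in the completion; [f] records its limit by the inner
    products with [U]. *)
Definition weak_limit (x : nat -> U) (f : U -> C^o) :=
  semi_cauchy x /\ forall y, (fun k => q (x k) y : C^o) @ \oo --> f y.

Lemma semi_cauchy_cst u : semi_cauchy (fun=> u).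
Proof. by move=> e e0; exists 0 => k l _ _; rewrite subrr semi_norm0. Qed.

Lemma semi_cauchyZD a x y :
  semi_cauchy x -> semi_cauchy y -> semi_cauchy (fun k => a *: x k + y k).
Proof.
move=> xc yc e e0; have a1 : 0 < `|a| + 1 by rewrite ltr_wpDl.
have e20 : 0 < e / 2 by rewrite divr_gt0.
have [|N xN] := xc (e / 2 / (`|a| + 1)); first by rewrite divr_gt0.
have [M yM] := yc _ e20; exists (maxn N M) => k l; rewrite !geq_max.
move=> /andP[Nk Mk] /andP[Nl Ml].
rewrite opprD addrACA -scalerBr (le_lt_trans (semi_normD _ _ _)) //.
rewrite [e]splitr ler_ltD ?yM // semi_normZ.
have /ltW := xN _ _ Nk Nl; rewrite ler_pdivlMr //; apply: le_trans.
by rewrite [leRHS]mulrC ler_wpM2r ?semi_norm_ge0 // lerDl.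
Qed.

Lemma semi_cauchy_bounded x : semi_cauchy x ->
  exists N, exists2 M : C, 0 < M & forall k, (N <= k)%N -> 'N (x k) <= M.
Proof.
move=> /(_ 1 ltr01)[N xN]; exists N; exists ('N (x N) + 1).
  by rewrite ltr_wpDl ?semi_norm_ge0.
move=> k Nk; rewrite -[x k](subrK (x N)) (le_trans (semi_normD _ _ _)) //.
by rewrite addrC lerD2l ltW // xN.
Qed.

Lemma semi_cauchy_form x z : semi_cauchy x -> semi_cauchy z ->
  cvgn (fun k => q (x k) (z k) : C^o).
Proof.
move=> xc zc; apply: cauchy_seqC => e e0.
have [N1 [A A0 xA]] := semi_cauchy_bounded xc.
have [N2 [B B0 zB]] := semi_cauchy_bounded zc.
have [|N3 xN] := xc (e / 2 / B); first by rewrite !divr_gt0.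
have [|N4 zN] := zc (e / 2 / A); first by rewrite !divr_gt0.
exists (maxn (maxn N1 N2) (maxn N3 N4)) => k l; rewrite !geq_max.
move=> /andP[/andP[k1 k2] /andP[k3 k4]] /andP[/andP[l1 l2] /andP[l3 l4]].
have -> : q (x k) (z k) - q (x l) (z l) =
    q (x k - x l) (z k) + q (x l) (z k - z l).
  by rewrite linearBl linearBr /= addrA subrK.
rewrite (le_lt_trans (ler_normD _ _)) // [e]splitr ltr_leD //.
  apply: le_lt_trans (semi_CauchySchwarz_sqrt _ _ _) _.
  rewrite -[ltRHS](divfK (lt0r_neq0 B0)).
  apply: le_lt_trans (_ : _ <= 'N (x k - x l) * B) _.
    by rewrite ler_wpM2l ?semi_norm_ge0 ?zB.
  by rewrite ltr_pM2r // xN.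
apply: le_trans (semi_CauchySchwarz_sqrt _ _ _) _.
rewrite -[leRHS](divfK (lt0r_neq0 A0)) mulrC.
by rewrite ler_pM ?semi_norm_ge0 ?xA // ltW // zN.
Qed.

(** Freezing [z] at a late index [N2] leaves [y] against a fixed vector, which tends to 0, and a
    remainder that is small by Cauchy-Schwarz, since [y] is bounded. *)
Lemma weak_null_form y z : weak_limit y (fun=> 0) -> semi_cauchy z ->
  (fun k => q (y k) (z k) : C^o) @ \oo --> (0 : C^o).
Proof.
move=> [yc y0] zc; apply/cvgrPdist_lt => e e0.
have [N1 [A A0 yA]] := semi_cauchy_bounded yc.
have e20 : 0 < e / 2 by rewrite divr_gt0.
have [|N2 zN] := zc (e / 2 / A); first by rewrite !divr_gt0.
have /cvgrPdist_lt /(_ _ e20) y0N := y0 (z N2).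
near=> k; rewrite sub0r normrN.
have -> : q (y k) (z k) = q (y k) (z N2) + q (y k) (z k - z N2).
  by rewrite linearBr /= addrC subrK.
rewrite (le_lt_trans (ler_normD _ _)) // [e]splitr ltr_leD //.
  by rewrite -normrN -sub0r; near: k.
apply: le_trans (semi_CauchySchwarz_sqrt _ _ _) _.
rewrite -[leRHS](divfK (lt0r_neq0 A0)) mulrC.
rewrite ler_pM ?semi_norm_ge0 //.
  by rewrite ltW // zN //; near: k; exists N2.
by apply: yA; near: k; exists N1.
Unshelve. all: by end_near. Qed.

Lemma weak_limit_cst u : weak_limit (fun=> u) (q u).
Proof. by split=> [|y]; [exact: semi_cauchy_cst|exact: cvg_cst]. Qed.

Lemma weak_limitZD a x y f g : weak_limit x f -> weak_limit y g ->
  weak_limit (fun k => a *: x k + y k) (a *: f + g).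
Proof.
move=> [xc xf] [yc yg]; split=> [|z]; first exact: semi_cauchyZD.
rewrite (_ : (fun k => _) = (fun k => a * q (x k) z + q (y k) z : C^o)).
  by apply: cvgD => //; apply: cvgMr.
by apply/funext => k; rewrite linearDl /= semi_formZl.
Qed.

Lemma weak_limitB x y f : weak_limit x f -> weak_limit y f ->
  weak_limit (fun k => x k - y k) (fun=> 0).
Proof.
move=> xf yf; have := weak_limitZD (-1) yf xf.
rewrite scaleN1r addNr; congr weak_limit.
by apply/funext => k; rewrite scaleN1r addrC.
Qed.

(** This makes the inner product of the completion well defined. In [q x z = q (x - x') z + q x' (z
    - z') + q x' z'] the first two terms tend to 0 by [weak_null_form]. *)
Lemma weak_limit_form_unique x x' z z' f g :
  weak_limit x f -> weak_limit x' f -> weak_limit z g -> weak_limit z' g ->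
  lim ((fun k => q (x k) (z k) : C^o) @ \oo) =
  lim ((fun k => q (x' k) (z' k) : C^o) @ \oo).
Proof.
move=> xf xf' zg zg'; apply: cvg_seq_unique (semi_cauchy_form xf.1 zg.1) _.
have h1 := weak_null_form (weak_limitB xf xf') zg.1.
have h2 := weak_null_form (weak_limitB zg zg') xf'.1.
have {h2} := cvg_conjC h2; rewrite rmorph0 => h2.
have h3 := cvgD (cvgD h1 h2) (semi_cauchy_form xf'.1 zg'.1).
rewrite !add0r in h3; apply: cvg_trans (h3 _ _); apply: near_eq_cvg.
apply: nearW => k /=; rewrite !fctE /= -semi_formC linearBl linearBr /=.
by rewrite addrA !subrK.
Qed.

End WeakLimits.

(** Supplies the radii with which a sequence is extracted from a Cauchy filter. *)
Lemma vanishing_seqC (R : realType) : exists2 r : nat -> R[i],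
  (forall k, 0 < r k) &
  (forall e, 0 < e -> exists N, forall k, (N <= k)%N -> r k < e).
Proof.
exists (fun k => (k.+1%:R^-1)%:C) => [k|e e0].
  by rewrite ltcR invr_gt0.
have ee : (complex.Re e)%:C = e by rewrite RRe_real // gtr0_real.
have e0' : 0 < complex.Re e by rewrite -ltcR ee.
have [N _ NP] := near_infty_natSinv_lt (PosNum e0').
by exists N => k /NP /=; rewrite -ltcR ee.
Qed.

(** * The completion as a Hilbert space of functionals *)

Section Completion.
Variables (R : realType) (U : lmodType R[i]) (q : semi_inner U).
Local Notation C := R[i].

(* A point [f] of the completion is identified with the functional [q f] on
   [U], the pointwise limit of [q (x k)] for a Cauchy sequence [x] tending to
   [f]; this makes the linear structure that of functions. *)
Definition completion_pred : {pred U -> C^o} :=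
  fun f => `[< exists x, weak_limit q x f >].

Lemma completion_submod : submod_closed completion_pred.
Proof.
split=> [|a f g /asboolP[x xf] /asboolP[y yg]]; apply/asboolP.
  exists (fun=> 0); have := weak_limit_cst q 0; congr weak_limit.
  by apply/funext => y; rewrite linear0l.
by exists (fun k => a *: x k + y k); exact: weak_limitZD.
Qed.

HB.instance Definition _ :=
  GRing.isSubmodClosed.Build C (U -> C^o) completion_pred completion_submod.

Record completion := Completion {
  completion_val :> U -> C^o;
  completion_valP : completion_val \in completion_pred }.

HB.instance Definition _ := [isSub for completion_val].
HB.instance Definition _ := [Choice of completion by <:].
HB.instance Definition _ := [SubChoice_isSubLmodule of completion by <:].

Lemma completion_limit (f : completion) : {x | weak_limit q x f}.
Proof. by apply: cid; have /asboolP := completion_valP f. Qed.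

Definition completion_seq f := sval (completion_limit f).

Lemma completion_seqP f : weak_limit q (completion_seq f) f.
Proof. exact: svalP (completion_limit f). Qed.

Lemma in_completion u : (q u : U -> C^o) \in completion_pred.
Proof. by apply/asboolP; exists (fun=> u); exact: weak_limit_cst. Qed.

Definition completion_inj u : completion := Completion (in_completion u).

Lemma completion_inj_linear : linear completion_inj.
Proof.
move=> a u v; apply/val_inj/funext => y /=.
by rewrite linearDl /= semi_formZl.
Qed.

HB.instance Definition _ :=
  GRing.isLinear.Build C U completion _ completion_inj completion_inj_linear.

(** The value serves all representing sequences at once, so each later computation may take the most
    convenient ones. *)
Lemma completion_form (f g : completion) : {c : C |
  forall x z, weak_limit q x f -> weak_limit q z g ->
    (fun k => q (x k) (z k) : C^o) @ \oo --> (c : C^o)}.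
Proof.
have [xf zg] := (completion_seqP f, completion_seqP g).
exists (lim ((fun k => q (completion_seq f k) (completion_seq g k) : C^o)
  @ \oo)) => x z xf' zg'.
rewrite (weak_limit_form_unique xf xf' zg zg').
exact: semi_cauchy_form xf'.1 zg'.1.
Qed.

Definition cinner (f g : completion) : C := sval (completion_form f g).

Lemma cinner_cvg x z (f g : completion) :
  weak_limit q x f -> weak_limit q z g ->
  (fun k => q (x k) (z k) : C^o) @ \oo --> (cinner f g : C^o).
Proof. exact: svalP (completion_form f g) x z. Qed.

Lemma weak_limit_inj u : weak_limit q (fun=> u) (completion_inj u).
Proof. exact: weak_limit_cst. Qed.

Lemma cinnerE x z (f g : completion) c :
  weak_limit q x f -> weak_limit q z g ->
  (fun k => q (x k) (z k) : C^o) @ \oo --> (c : C^o) -> cinner f g = c.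
Proof. by move=> xf zg; apply: cvg_seq_unique; exact: cinner_cvg. Qed.

Lemma cinner_inj u v : cinner (completion_inj u) (completion_inj v) = q u v.
Proof.
apply: cinnerE (weak_limit_inj u) (weak_limit_inj v) _; exact: cvg_cst.
Qed.

Lemma cinnerC f g : cinner f g = (cinner g f)^*.
Proof.
apply: cinnerE (completion_seqP f) (completion_seqP g) _.
have /cvg_conjC := cinner_cvg (completion_seqP g) (completion_seqP f).
apply: cvg_trans; apply: near_eq_cvg; apply: nearW => k /=.
by rewrite -semi_formC.
Qed.

Lemma completion_limitZD a x z (f g : completion) :
  weak_limit q x f -> weak_limit q z g ->
  weak_limit q (fun k => a *: x k + z k) (a *: f + g : completion).
Proof. exact: weak_limitZD. Qed.

Lemma cinner_linl g : GRing.linear_for *%R (cinner^~ g).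
Proof.
move=> a f f' /=.
have [xf xf'] := (completion_seqP f, completion_seqP f').
have xg := completion_seqP g.
have := cinnerE (completion_limitZD a xf xf') xg; apply.
rewrite (_ : (fun k => _) = (fun k =>
    a * q (completion_seq f k) (completion_seq g k) +
    q (completion_seq f' k) (completion_seq g k) : C^o)).
  by apply: cvgD; [apply: cvgMr|]; exact: cinner_cvg.
by apply/funext => k; rewrite linearDl /= semi_formZl.
Qed.

Lemma cinner_bilinear :
  bilinear_for *%R (@Num.conj C \; *%R)
    (cinner : completion -> completion -> C).
Proof.
split=> u; first exact: cinner_linl.
move=> a f g; rewrite [LHS]cinnerC cinner_linl rmorphD rmorphM /=.
by rewrite (cinnerC u f) (cinnerC u g).
Qed.

Lemma cinner_hermitian f g : cinner f g = (-1) ^+ false * (cinner g f)^*.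
Proof. by rewrite mul1r; exact: cinnerC. Qed.

HB.instance Definition _ := bilinear_isBilinear.Build C completion completion C
  _ _ cinner cinner_bilinear.
HB.instance Definition _ := isHermitianSesquilinear.Build C completion
  false (@Num.conj C) cinner cinner_hermitian.

Lemma cinner_ge0 f : 0 <= cinner f f.
Proof.
apply: cvg_seq_ge0 (cinner_cvg (completion_seqP f) (completion_seqP f)) _.
by apply: nearW => k; exact: semi_form_ge0.
Qed.

Definition cinner_semi := SemiInner cinner_ge0.

(** This reproducing property makes [cinner] definite: by Cauchy-Schwarz a vector of square zero
    pairs to 0 with every [completion_inj y], so it is the zero functional. *)
Lemma cinner_eval f y : cinner f (completion_inj y) = f y.
Proof.
have [fc fy] := completion_seqP f.
exact: cinnerE (conj fc fy) (weak_limit_inj y) (fy y).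
Qed.

Lemma cinner_gt0 f : f != 0 -> 0 < cinner f f.
Proof.
rewrite lt_def cinner_ge0 andbT; apply: contraNN => /eqP f0.
apply/eqP/val_inj/funext => y /=; rewrite -cinner_eval.
have := semi_CauchySchwarz cinner_semi f (completion_inj y).
rewrite /= f0 mul0r => h; apply/eqP; rewrite -normr_eq0 -sqrf_eq0.
by rewrite eq_le h exprn_ge0.
Qed.

HB.instance Definition _ := isDotProduct.Build C completion cinner cinner_gt0.

Lemma cnorm_eq0 f : semi_norm cinner_semi f = 0 -> f = 0.
Proof.
move=> /eqP; rewrite sqrtC_eq0 => /eqP f0; apply/eqP/negP => /negP /cinner_gt0.
by rewrite lt_def f0 eqxx.
Qed.

HB.instance Definition _ := Lmodule_isNormed.Build C completion
  (@semi_normD _ _ cinner_semi) (@semi_normZ _ _ cinner_semi) cnorm_eq0.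

Lemma cnorm_sqr (f : completion) : `|f| ^+ 2 = cinner f f.
Proof. exact: semi_normK. Qed.

(** The sequence [x k - x l] represents the difference, and its squared seminorms are eventually at
    most [e ^+ 2]; the bound passes to the limit. *)
Lemma weak_limit_dist x (f : completion) (e : C) N :
  weak_limit q x f ->
  (forall k l, (N <= k)%N -> (N <= l)%N -> semi_norm q (x k - x l) < e) ->
  forall l, (N <= l)%N -> `|f - completion_inj (x l)| <= e.
Proof.
move=> xf xN l Nl; have e0 : 0 <= e.
  by apply: le_trans (ltW (xN l l Nl Nl)); exact: semi_norm_ge0.
rewrite -ler_sqr ?nnegrE // cnorm_sqr -subr_ge0.
have wl : weak_limit q (fun k => x k - x l) (f - completion_inj (x l)).
  have -> : f - completion_inj (x l) = -1 *: completion_inj (x l) + f.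
    by rewrite scaleN1r addrC.
  have := completion_limitZD (-1) (weak_limit_inj (x l)) xf.
  by congr weak_limit; apply/funext => k; rewrite scaleN1r addrC.
apply: cvg_seq_ge0 (cvgB (cvg_cst (e ^+ 2 : C^o)) (cinner_cvg wl wl)) _.
exists N => //= k /= Nk.
rewrite !fctE subr_ge0 -semi_normK ler_sqr ?nnegrE ?semi_norm_ge0 //.
by rewrite ltW // xN.
Qed.

Lemma completion_dense (f : completion) (e : C) : 0 < e ->
  exists u, `|f - completion_inj u| < e.
Proof.
move=> e0; have fx := completion_seqP f.
have [|N xN] := fx.1 (e / 2); first by rewrite divr_gt0.
exists (completion_seq f N).
apply: le_lt_trans (weak_limit_dist fx xN _) _ => //.
by rewrite ltr_pdivrMr // mulr_natr mulr2n ltrDl.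
Qed.

Lemma norm_completion_inj u : `|completion_inj u| = semi_norm q u.
Proof. by rewrite /Num.norm /= /semi_norm /= cinner_inj. Qed.

(** By density, balls of radius [r k] that belong to [F] can be centred at images of vectors [x k]
    of [U]. Any two of these balls meet, so [x] is Cauchy, and the functional that it defines is the
    limit of [F]. *)
Lemma completion_complete (F : set_system completion) :
  ProperFilter F -> cauchy F -> cvg F.
Proof.
move=> FF /cauchyP Fc.
have [r r0 small] := vanishing_seqC R.
have /choice[x xP] : forall k, exists u, F (ball (completion_inj u) (r k)).
  move=> k.
  have e20 : 0 < r k / 2 by rewrite divr_gt0.
  have [f Ff] := Fc _ e20; have [u fu] := completion_dense f e20.
  exists u; apply: filterS Ff => g; rewrite -!ball_normE /= => fg.
  rewrite -[completion_inj u](subrK f) -addrA.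
  apply: le_lt_trans (ler_normD _ _) _.
  by rewrite [r k]splitr; apply: ltrD; [rewrite distrC; exact: fu|exact: fg].
have xxP k l : semi_norm q (x k - x l) < r k + r l.
  have [g] := filter_ex (filterI (xP k) (xP l)).
  rewrite -!ball_normE => -[/= xg yg].
  rewrite -norm_completion_inj raddfB /= -[completion_inj (x k)](subrK g).
  rewrite -addrA; apply: le_lt_trans (ler_normD _ _) _.
  by apply: ltrD; [exact: xg|rewrite distrC; exact: yg].
have xc : semi_cauchy q x.
  move=> e e0; have [|N NP] := small (e / 2); first by rewrite divr_gt0.
  exists N => k l Nk Nl; rewrite (lt_trans (xxP k l)) //.
  by rewrite [e]splitr ltrD ?NP.
pose f0 y := lim ((fun k => q (x k) y : C^o) @ \oo) : C^o.
have xf0 : weak_limit q x f0.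
  by split=> // y; exact: semi_cauchy_form xc (semi_cauchy_cst q y).
have fP : (f0 : U -> C^o) \in completion_pred by apply/asboolP; exists x.
apply/cvg_ex; exists (Completion fP); apply/cvg_ballP => e e0.
have e20 : 0 < e / 2 by rewrite divr_gt0.
have e40 : 0 < e / 2 / 2 by rewrite divr_gt0.
have [N NP] := small _ e40.
have dist : `|Completion fP - completion_inj (x N)| <= e / 2.
  apply: (@weak_limit_dist x (Completion fP) _ N) => // k l Nk Nl.
  by rewrite (lt_trans (xxP k l)) // [e / 2]splitr ltrD ?NP.
apply: filterS (xP N) => g; rewrite -!ball_normE /= => xg.
rewrite -[Completion fP](subrK (completion_inj (x N))) -addrA.
apply: le_lt_trans (ler_normD _ _) _; rewrite [e]splitr.
apply: ler_ltD; first exact: dist.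
apply: lt_trans xg (lt_trans (NP N (leqnn N)) _).
by rewrite ltr_pdivrMr // mulr_natr mulr2n ltrDl.
Qed.

HB.instance Definition _ :=
  Uniform_isComplete.Build completion completion_complete.
HB.instance Definition _ :=
  CompleteNormedModule_isHilbert.Build R completion cnorm_sqr.

End Completion.

(** Hides the construction: a form-preserving linear map with dense image is all that the dilation
    needs. *)
Theorem semi_inner_completion (R : realType) (U : lmodType R[i])
    (q : semi_inner U) :
  exists (K : hilbertType R) (j : {linear U -> K}),
    (forall u v, inner (j u) (j v) = q u v) /\
    (forall f e, 0 < e -> exists u, `|f - j u| < e).
Proof.
exists (completion q : hilbertType R),
  (completion_inj q : {linear U -> completion q}).
split=> [u v|f e]; [exact: cinner_inj|exact: completion_dense].
Qed.

(** * Extension of contractions from a dense subspace *)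

Section DenseExtension.
Variables (C : numFieldType) (U : lmodType C) (K : normedModType C).
Variable j : {linear U -> K}.
Hypothesis j_dense : forall k e, 0 < e -> exists u, `|k - j u| < e.

Lemma norm_lt_eq0 (L : normedModType C) (x : L) :
  (forall e, 0 < e -> `|x| < e) -> x = 0.
Proof.
move=> xe; apply/eqP; rewrite -normr_eq0; apply: contraT => x0.
by have := xe `|x|; rewrite normr_gt0 -normr_eq0 ltxx => /(_ x0).
Qed.

(** Stands in for a minimum, as the order of [C] is partial: [a * b / (a + b)] is below both without
    comparing them. *)
Lemma exists_lt2 (a b : C) : 0 < a -> 0 < b ->
  exists c, [/\ 0 < c, c <= a & c <= b].
Proof.
move=> a0 b0; have ab : 0 < a + b by rewrite addr_gt0.
exists (a * b / (a + b)); split; first by rewrite divr_gt0 ?mulr_gt0.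
  by rewrite ler_pdivrMr // ler_pM2l // lerDr ltW.
by rewrite ler_pdivrMr // mulrC ler_pM2l // lerDl ltW.
Qed.

(** A Lipschitz bound is asked instead of linearity, so that the lemma also applies to the
    conjugate-linear variable of an inner product. *)
Lemma dense_eq0 (f : K -> C) (M : C) : 0 <= M ->
  (forall u, f (j u) = 0) -> (forall k l, `|f k - f l| <= M * `|k - l|) ->
  forall k, f k = 0.
Proof.
move=> M0 fj fM k; apply: (@norm_lt_eq0 C^o) => e e0.
have M1 : 0 < M + 1 by rewrite ltr_wpDl.
have [|u ku] := j_dense k (e := e / (M + 1)); first by rewrite divr_gt0.
have := fM k (j u); rewrite fj subr0 => /le_lt_trans; apply.
apply: le_lt_trans (_ : _ <= (M + 1) * `|k - j u|) _.
  by rewrite ler_wpM2r // lerDl.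
by rewrite mulrC -ltr_pdivlMr.
Qed.

Variables (L : completeNormedModType C) (phi : {linear U -> L}).
Hypothesis phi_le : forall u, `|phi u| <= `|j u|.

(** The graph of the extension: the closure of the set of pairs [(j u, phi u)]. *)
Let ext k l := forall e, 0 < e -> exists u, `|k - j u| < e /\ `|l - phi u| < e.

(** The images under [phi] of the vectors [u] with [j u] near [k] generate a Cauchy filter, because
    [phi] is dominated by [j]; its limit is the required point. *)
Lemma ext_exists k : exists l, ext k l.
Proof.
pose F := filter_from [set e : C | 0 < e]
  (fun e => phi @` [set u | `|k - j u| < e]).
have FF : ProperFilter F.
  apply: filter_from_proper; last first.
    by move=> e /= e0; have [u ku] := j_dense k e0; exists (phi u), u.
  apply: filter_from_filter; first by exists 1 => /=.
  move=> a b /= a0 b0; have [c [c0 ca cb]] := exists_lt2 a0 b0.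
  exists c => // _ [u /= ku <-].
  by split; exists u => //=; apply: lt_le_trans ku _.
have /cauchy_cvgP /cvg_ex[l Fl] : cauchy F.
  apply/cauchyP => e e0; have e20 : 0 < e / 2 by rewrite divr_gt0.
  have [u ku] := j_dense k e20; exists (phi u), (e / 2) => // _ [v /= kv <-].
  rewrite -ball_normE /= -raddfB (le_lt_trans (phi_le _)) // raddfB /=.
  rewrite -[j u](subrK k) -addrA (le_lt_trans (ler_normD _ _)) //.
  by rewrite [e]splitr ltrD // distrC.
exists l => e e0.
have /Fl[d /= d0 dF] : nbhs l (ball l e) by apply: nbhsx_ballx.
have [c [c0 ce cd]] := exists_lt2 e0 d0; have [u ku] := j_dense k c0.
exists u; split; first exact: lt_le_trans ku ce.
have /dF : (phi @` [set u | `|k - j u| < d]) (phi u).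
  by exists u => //=; exact: lt_le_trans ku cd.
by rewrite -ball_normE.
Qed.

Lemma ext_norm k l : ext k l -> `|l| <= `|k|.
Proof.
move=> kl; have [//|kl0] := real_leP (normr_real l) (normr_real k).
(* With half of the supposed excess, the two approximation errors add up to less than the excess. *)
have [|u [ku lu]] := kl ((`|l| - `|k|) / 2).
  by rewrite divr_gt0 ?subr_gt0.
suff : `|l| < `|l| by rewrite ltxx.
rewrite -{1}[l](subrK (phi u)); apply: le_lt_trans (ler_normD _ _) _.
have jk : `|j u| <= `|j u - k| + `|k| by rewrite -{1}[j u](subrK k) ler_normD.
apply: le_lt_trans (_ : _ <= `|l - phi u| + (`|k - j u| + `|k|)) _.
  by rewrite lerD2l (le_trans (phi_le _)) // [ `|k - _|]distrC.
rewrite addrA -ltrBrDr; apply: lt_le_trans (ltrD lu ku) _.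
by rewrite -splitr.
Qed.

Lemma ext_phi u : ext (j u) (phi u).
Proof. by move=> e e0; exists u; rewrite !subrr !normr0. Qed.

Lemma ext_lin a k k' l l' :
  ext k l -> ext k' l' -> ext (a *: k + k') (a *: l + l').
Proof.
move=> kl kl' e e0; have a1 : 0 < `|a| + 1 by rewrite ltr_wpDl.
have [|u [ku lu]] := kl (e / 2 / (`|a| + 1)); first by rewrite !divr_gt0.
have [|v [kv lv]] := kl' (e / 2); first by rewrite divr_gt0.
have main (M : normedModType C) (x x' y y' : M) :
    `|x - y| < e / 2 / (`|a| + 1) -> `|x' - y'| < e / 2 ->
    `|(a *: x + x') - (a *: y + y')| < e.
  move=> xy xy'; rewrite opprD addrACA -scalerBr.
  apply: le_lt_trans (ler_normD _ _) _; rewrite [e]splitr.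
  apply: ler_ltD => //; rewrite normrZ.
  apply: le_trans (_ : _ <= `|x - y| * (`|a| + 1)) _.
    by rewrite mulrC ler_wpM2l // lerDl.
  by rewrite -ler_pdivlMr // ltW.
exists (a *: u + v).
by split; rewrite linearP; [exact: (main K)|exact: (main L)].
Qed.

(** By linearity of the graph, [l - l'] lies over 0, and [ext_norm] forces it to vanish. *)
Lemma ext_unique k l l' : ext k l -> ext k l' -> l = l'.
Proof.
move=> kl kl'; apply/eqP; rewrite -subr_eq0 -normr_le0 -(normr0 K).
apply: ext_norm; rewrite -[0](subrr k).
have := ext_lin (-1) kl' kl; rewrite !scaleN1r.
by rewrite [- k + k]addrC [- l' + l]addrC.
Qed.

Lemma dense_extension : exists Phi : {linear K -> L},
  (forall u, Phi (j u) = phi u) /\ (forall k, `|Phi k| <= `|k|).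
Proof.
have /choice[f fP] := ext_exists.
have f_lin : linear f.
  by move=> a k k'; apply: ext_unique (fP _) _; exact: ext_lin.
pose aux := GRing.isLinear.Build C K L _ f f_lin.
pose Phi : {linear K -> L} := HB.pack f aux.
exists Phi; split=> [u|k]; last exact: ext_norm (fP k).
exact: ext_unique (fP _) (ext_phi u).
Qed.

End DenseExtension.

(** * The form on finitely supported families *)

Section Words.
Variable n : nat.

(** Words of length strictly below [N], grouped by first letter so that sums split as in
    [big_wordsS]. *)
Fixpoint words (N : nat) : seq (seq 'I_n) :=
  if N is N'.+1 then [::] :: [seq j :: a | j <- enum 'I_n, a <- words N']
  else [::].

Lemma mem_words N a : (a \in words N) = (size a < N)%N.
Proof.
elim: N a => [|N IHN] [|j a] //=; rewrite inE /= ltnS -IHN.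
apply/allpairsP/idP => [[[i b] /= [_ bN [_ ->]]] //|aN].
by exists (j, a); rewrite mem_enum.
Qed.

Lemma uniq_words N : uniq (words N).
Proof.
elim: N => //= N IHN; apply/andP; split.
  by apply/allpairsP => -[[i b] /= []].
apply: allpairs_uniq => //; first exact: enum_uniq.
by move=> [i a] [j b] _ _ /= [-> ->].
Qed.

Lemma big_wordsS (V : nmodType) N (F : seq 'I_n -> V) :
  \sum_(a <- words N.+1) F a =
  F [::] + \sum_j \sum_(a <- words N) F (j :: a).
Proof. by rewrite /= big_cons big_allpairs_dep big_enum. Qed.

Lemma big_words_widen (V : nmodType) N M (F : seq 'I_n -> V) : (N <= M)%N ->
  (forall a, (N <= size a)%N -> F a = 0) ->
  \sum_(a <- words M) F a = \sum_(a <- words N) F a.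
Proof.
elim: N M F => [|N IHN] M F NM F0.
  by rewrite [RHS]big_nil big1 // => a _; exact: F0.
case: M NM => // M NM; rewrite !big_wordsS; congr (_ + _).
by apply: eq_bigr => j _; apply: IHN => // a Na; exact: F0.
Qed.

(** Needed because the joint form prepends letters whereas [backward] appends them. *)
Lemma big_words_rev (V : nmodType) N (F : seq 'I_n -> V) :
  \sum_(a <- words N) F (rev a) = \sum_(a <- words N) F a.
Proof.
rewrite -(big_map rev xpredT F); apply: perm_big; apply: uniq_perm.
- by rewrite map_inj_uniq ?uniq_words //; exact: inv_inj revK.
- exact: uniq_words.
- move=> a; rewrite -{1}[a]revK mem_map ?mem_words ?size_rev //.
  exact: inv_inj revK.
Qed.

End Words.

(** * Inner product identities *)

Section HilbertTheory.
Variables (R : realType) (H : hilbertType R).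
Local Notation C := R[i].

Lemma innerC (x y : H) : inner x y = (inner y x)^*.
Proof. by rewrite [LHS]hermC mul1r. Qed.

Definition inner_semi : semi_inner H := SemiInner (dnorm_ge0 (@inner R H)).

Lemma inner_semi_normE (x : H) : semi_norm inner_semi x = `|x|.
Proof. by rewrite /semi_norm /= -inner_norm sqrCK. Qed.

Lemma inner_CauchySchwarz (x y : H) : `|inner x y| <= `|x| * `|y|.
Proof.
by rewrite -!inner_semi_normE; exact: (semi_CauchySchwarz_sqrt inner_semi).
Qed.

Lemma innerZl a (x y : H) : inner (a *: x) y = a * inner x y.
Proof. exact: linearZl_LR. Qed.

Lemma innerZr a (x y : H) : inner x (a *: y) = a^* * inner x y.
Proof. exact: linearZr_LR. Qed.

Lemma innerPl a (x y z : H) : inner (a *: x + y) z = a * inner x z + inner y z.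
Proof. by rewrite linearDl /= innerZl. Qed.

Lemma inner_suml I (r : seq I) (F : I -> H) y :
  inner (\sum_(i <- r) F i) y = \sum_(i <- r) inner (F i) y.
Proof. exact: linear_sumlz. Qed.

Lemma inner_sumr I (r : seq I) (F : I -> H) x :
  inner x (\sum_(i <- r) F i) = \sum_(i <- r) inner x (F i).
Proof. exact: linear_sumr. Qed.

End HilbertTheory.

(** * The form Q, the creation operators and the vacuum vectors *)

Section FockForm.
Variables (R : realType) (H : hilbertType R) (n : nat).
Variable T : 'I_n -> {linear H -> H}.
Local Notation C := R[i].
Local Notation word := (seq 'I_n).

(** Equivalent to finite support for some [N], as there are finitely many words of each length. *)
Definition bounded_support (N : nat) (f : word -> H) :=
  forall a, (N <= size a)%N -> f a = 0.

Definition fock_pred : {pred word -> H} :=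
  fun f => `[< exists N, bounded_support N f >].

Lemma bounded_support_leq N M f :
  (N <= M)%N -> bounded_support N f -> bounded_support M f.
Proof. by move=> NM f0 a Ma; apply: f0; exact: leq_trans Ma. Qed.

Lemma fock_submod : submod_closed fock_pred.
Proof.
split=> [|c f g /asboolP[N f0] /asboolP[M g0]]; apply/asboolP.
  by exists 0.
exists (maxn N M) => a; rewrite geq_max => /andP[Na Ma].
by rewrite fctE /= [(c *: f) a](_ : _ = c *: f a) // f0 // g0 // scaler0 addr0.
Qed.

HB.instance Definition _ :=
  GRing.isSubmodClosed.Build C (word -> H) fock_pred fock_submod.

Record fock := Fock {
  fock_val :> word -> H; fock_valP : fock_val \in fock_pred }.

HB.instance Definition _ := [isSub for fock_val].
HB.instance Definition _ := [Choice of fock by <:].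
HB.instance Definition _ := [SubChoice_isSubLmodule of fock by <:].

Lemma fock_bounded_support (f : fock) : {N | bounded_support N f}.
Proof. by apply: cid; have /asboolP := fock_valP f. Qed.

Lemma fockE c (f g : fock) a : (c *: f + g) a = c *: f a + g a.
Proof. by []. Qed.

Definition backward (f : word -> H) (a : word) := \sum_j T j (f (rcons a j)).

Definition defect (f : word -> H) (a : word) := f a - backward f a.

Lemma backward_support N f :
  bounded_support N f -> bounded_support N (backward f).
Proof.
move=> f0 a Na; apply: big1 => j _.
by rewrite f0 ?linear0 // size_rcons leqW.
Qed.

Lemma defect_support N f : bounded_support N f -> bounded_support N (defect f).
Proof.
by move=> f0 a Na; rewrite /defect f0 // (backward_support f0) // subr0.
Qed.

Lemma backward_lin c (f g : fock) a :
  backward (c *: f + g) a = c *: backward f a + backward g a.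
Proof.
rewrite /backward scaler_sumr -big_split; apply: eq_bigr => j _.
by rewrite fockE linearP.
Qed.

Lemma defect_lin c (f g : fock) a :
  defect (c *: f + g) a = c *: defect f a + defect g a.
Proof.
by rewrite /defect fockE backward_lin opprD addrACA scalerBr.
Qed.

Definition fock_term (f g : word -> H) a : C :=
  2^-1 * (inner (defect f a) (g a) + inner (f a) (defect g a)).

(** A bound for the support of [f] alone suffices, because [defect] does not enlarge supports;
    [fock_formE] frees the sum from the chosen bound. *)
Definition fock_form (f g : fock) : C :=
  \sum_(a <- words n (sval (fock_bounded_support f))) fock_term f g a.

Lemma fock_formE N (f g : fock) : bounded_support N f ->
  fock_form f g = \sum_(a <- words n N) fock_term f g a.
Proof.
move=> f0; rewrite /fock_form; case: (fock_bounded_support f) => M /= f0'.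
have term0 L a : bounded_support L f -> (L <= size a)%N -> fock_term f g a = 0.
  move=> fL La; rewrite /fock_term fL // (defect_support fL) //.
  by rewrite !linear0l addr0 mulr0.
rewrite -(big_words_widen (leq_maxl M N) (fun a => term0 M a f0')).
exact: big_words_widen (leq_maxr M N) (fun a => term0 N a f0).
Qed.

Lemma fock_formC f g : fock_form f g = (fock_form g f)^*.
Proof.
pose N := maxn (sval (fock_bounded_support f)) (sval (fock_bounded_support g)).
have fN : bounded_support N f.
  exact: bounded_support_leq (leq_maxl _ _) (svalP (fock_bounded_support f)).
have gN : bounded_support N g.
  exact: bounded_support_leq (leq_maxr _ _) (svalP (fock_bounded_support g)).
rewrite (fock_formE _ fN) (fock_formE _ gN) rmorph_sum; apply: eq_bigr => a _.
rewrite /fock_term rmorphM rmorphD /= fmorphV rmorph_nat addrC.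
by rewrite (innerC (f a)) (innerC (defect f a)).
Qed.

Lemma fock_form_linl g : GRing.linear_for *%R (fock_form^~ g).
Proof.
move=> c f f'.
pose N := maxn (sval (fock_bounded_support f)) (sval (fock_bounded_support f')).
have fN : bounded_support N f.
  exact: bounded_support_leq (leq_maxl _ _) (svalP (fock_bounded_support f)).
have f'N : bounded_support N f'.
  exact: bounded_support_leq (leq_maxr _ _) (svalP (fock_bounded_support f')).
have lN : bounded_support N (c *: f + f' : fock).
  by move=> a Na; rewrite fockE fN // f'N // scaler0 addr0.
rewrite (fock_formE _ lN) (fock_formE _ fN) (fock_formE _ f'N).
rewrite mulr_sumr -big_split; apply: eq_bigr => a _.
rewrite /fock_term defect_lin fockE !innerPl.
by rewrite /=; ring.
Qed.

Lemma fock_form_bilinear :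
  bilinear_for *%R (@Num.conj C \; *%R) (fock_form : fock -> fock -> C).
Proof.
split=> u; first exact: fock_form_linl.
move=> a f g; rewrite [LHS]fock_formC fock_form_linl rmorphD rmorphM /=.
by rewrite (fock_formC u f) (fock_formC u g).
Qed.

Lemma fock_form_hermitian f g :
  fock_form f g = (-1) ^+ false * (fock_form g f)^*.
Proof. by rewrite mul1r; exact: fock_formC. Qed.

HB.instance Definition _ := bilinear_isBilinear.Build C fock fock C
  _ _ fock_form fock_form_bilinear.
HB.instance Definition _ := isHermitianSesquilinear.Build C fock
  false (@Num.conj C) fock_form fock_form_hermitian.

(** The free creation operator has 0 at the empty word; the entry put there instead is the one that
    makes the defect vanish at that word. *)
Definition creation_fun (i : 'I_n) (f : word -> H) (a : word) : H :=
  if a is j :: b then (if i == j then f b else 0) else T i (f [::]).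

Definition vacuum_fun (x : H) (a : word) : H := if a is [::] then x else 0.

Lemma creation_support i N f :
  bounded_support N f -> bounded_support N.+1 (creation_fun i f).
Proof. by move=> f0 [|j a] //= Na; case: eqP => // _; exact: f0. Qed.

Lemma vacuum_support x : bounded_support 1 (vacuum_fun x).
Proof. by case. Qed.

Lemma creation_in i (f : fock) : creation_fun i f \in fock_pred.
Proof.
apply/asboolP; case: (fock_bounded_support f) => N f0.
by exists N.+1; exact: creation_support.
Qed.

Lemma vacuum_in x : vacuum_fun x \in fock_pred.
Proof. by apply/asboolP; exists 1; exact: vacuum_support. Qed.

Definition creation i (f : fock) : fock := Fock (creation_in i f).

Definition vacuum x : fock := Fock (vacuum_in x).

Lemma creation_linear i : linear (creation i).
Proof.
move=> c f g; apply/val_inj/funext => -[|j a]; rewrite /= ?linearP //.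
rewrite [RHS](_ : _ = c *: creation_fun i f (j :: a) +
  creation_fun i g (j :: a)) //=.
by case: eqP => // _; rewrite scaler0 addr0.
Qed.

HB.instance Definition _ i :=
  GRing.isLinear.Build C fock fock _ (creation i) (creation_linear i).

Lemma vacuum_linear : linear vacuum.
Proof.
move=> c x y; apply/val_inj/funext => -[|j a] //=.
rewrite [RHS](_ : _ = c *: vacuum_fun x (j :: a) + vacuum_fun y (j :: a)) //=.
by rewrite scaler0 addr0.
Qed.

HB.instance Definition _ :=
  GRing.isLinear.Build C H fock _ vacuum vacuum_linear.

Lemma backward_creation_nil i f :
  backward (creation_fun i f) [::] = T i (f [::]).
Proof.
rewrite /backward (bigD1 i) //= eqxx big1 ?addr0 // => j /negbTE ji.
by rewrite eq_sym ji linear0.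
Qed.

Lemma defect_creation_nil i f : defect (creation_fun i f) [::] = 0.
Proof. by rewrite /defect backward_creation_nil subrr. Qed.

(** [backward] appends letters at the end and creation acts at the front, so the two commute away
    from the empty word. With [defect_creation_nil] this is [D V_i = S_i D]. *)
Lemma defect_creation_cons i f j a :
  defect (creation_fun i f) (j :: a) = if i == j then defect f a else 0.
Proof.
rewrite /defect /backward /=; case: eqP => // _.
by rewrite big1 ?subr0 // => l _; rewrite linear0.
Qed.

(** Every summand of the form contains a defect, so the empty word contributes nothing, and the
    other words are sorted by their first letter. *)
Lemma fock_form_creation i j f g :
  fock_form (creation i f) (creation j g) = (i == j)%:R * fock_form f g.
Proof.
case: (fock_bounded_support f) => N f0.
rewrite (@fock_formE N.+1 (creation i f) _ (creation_support i f0)).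
rewrite (fock_formE _ f0) big_wordsS.
rewrite {1}/fock_term !defect_creation_nil linear0l linear0r addr0 mulr0 add0r.
rewrite (bigD1 i) //= [X in _ + X]big1 ?addr0 => [|l li]; last first.
  apply: big1 => a _; rewrite /fock_term !defect_creation_cons /=.
  by rewrite [i == l]eq_sym (negbTE li) !linear0l addr0 mulr0.
rewrite mulr_sumr; apply: eq_bigr => a _.
rewrite /fock_term !defect_creation_cons /= eqxx [j == i]eq_sym.
by case: eqP; rewrite ?mul1r // mul0r !linear0r addr0 mulr0.
Qed.

Lemma defect_vacuum x : defect (vacuum_fun x) = vacuum_fun x.
Proof.
apply/funext => a; rewrite /defect /backward big1 ?subr0 // => j _.
by case: a => [|i a] /=; rewrite linear0.
Qed.

(** The adjoint of [vacuum] with respect to the form, by [fock_form_vacuum]. *)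
Definition fock_proj (f : fock) : H := f [::] - 2^-1 *: backward f [::].

Lemma fock_proj_linear : linear fock_proj.
Proof.
move=> c f g; rewrite /fock_proj backward_lin fockE scalerDr opprD addrACA.
by rewrite scalerBr !scalerA [2^-1 * c]mulrC.
Qed.

HB.instance Definition _ :=
  GRing.isLinear.Build C fock H _ fock_proj fock_proj_linear.

Lemma fock_form_vacuum f y : fock_form f (vacuum y) = inner (fock_proj f) y.
Proof.
(* Conjugate symmetry lets the sum run over the support of the vacuum family, which is just the
   empty word. *)
rewrite fock_formC (@fock_formE 1 (vacuum y) f (vacuum_support y)).
rewrite big_wordsS /=.
rewrite [X in _ + X]big1 ?addr0 => [|j _]; last by rewrite big_nil.
rewrite /fock_term defect_vacuum /= rmorphM fmorphV rmorph_nat rmorphD /=.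
rewrite -(innerC (f [::]) y) -(innerC (defect f [::]) y).
rewrite -[inner (f [::]) y]mul1r -innerPl scale1r -innerZl.
congr (inner _ y); rewrite /fock_proj /defect addrA -mulr2n scalerBr.
rewrite -(scaler_nat 2 (f [::])).
by rewrite scalerA mulVf ?scale1r // pnatr_eq0.
Qed.

Lemma fock_proj_vacuum x : fock_proj (vacuum x) = x.
Proof.
rewrite /fock_proj /backward big1 ?scaler0 ?subr0 //= => j _.
by rewrite linear0.
Qed.

Lemma word_op_creation_nil s x :
  word_op creation s (vacuum x) [::] = word_op T s x.
Proof. by elim: s => //= j s ->. Qed.

(** After a creation operator the defect at the empty word is 0, so [backward] has the same entry
    there as the family, and half of it remains. This is the source of the factor 2 in the
    dilation. *)
Lemma fock_proj_word_op s x : s != [::] ->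
  fock_proj (word_op creation s (vacuum x)) = 2^-1 *: word_op T s x.
Proof.
case: s => // j s _.
rewrite /fock_proj /= backward_creation_nil word_op_creation_nil.
rewrite -[X in X - _]scale1r -scalerBl.
by have -> : 1 - 2^-1 = 2^-1 :> C by field.
Qed.

(** This is [2 Q(f, f) = 2 |f|^2 - 2 Re <A f, f>], used in both directions of the equivalence. *)
Lemma sum_fock_term N (f : word -> H) :
  let z := \sum_(a <- words n N) inner (backward f a) (f a) in
  2 * \sum_(a <- words n N) fock_term f f a =
  2 * \sum_(a <- words n N) inner (f a) (f a) - (z + z^*).
Proof.
rewrite /= rmorph_sum -big_split !mulr_sumr -sumrB; apply: eq_bigr => a _.
rewrite /fock_term mulrA divff ?pnatr_eq0 // mul1r /defect.
rewrite linearBl linearBr /= (innerC (f a) (backward f a)).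
by rewrite addrACA -opprD mulr_natl mulr2n.
Qed.

Definition dissipative := forall N (f : word -> H), bounded_support N f ->
  `|\sum_(a <- words n N) inner (backward f a) (f a)| <=
   \sum_(a <- words n N) inner (f a) (f a).

Hypothesis T_dissipative : dissipative.

Lemma fock_form_ge0 f : 0 <= fock_form f f.
Proof.
case: (fock_bounded_support f) => N f0; rewrite (fock_formE _ f0).
rewrite -(pmulr_rge0 _ (ltr0n _ 2)) sum_fock_term subr_ge0.
apply: le_trans (real_ler_norm _) _.
  by apply/CrealP; rewrite rmorphD /= conjCK addrC.
rewrite (le_trans (ler_normD _ _)) // norm_conjC -mulr2n -(mulr_natl `|_| 2).
by rewrite ler_pM2l ?ltr0n // T_dissipative.
Qed.

Definition fock_semi := SemiInner fock_form_ge0.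

End FockForm.

Lemma norm_isometry (R : realType) (H K : hilbertType R) (V : {linear H -> K}) :
  isometry inner inner V -> forall x, `|V x| = `|x|.
Proof.
move=> Viso x; apply/eqP; rewrite -(eqrXn2 (n := 2)) //; apply/eqP.
by rewrite !inner_norm Viso.
Qed.

(** * Inner product relations on a dense subspace *)

Section HilbertDense.
Variables (R : realType) (U : lmodType R[i]) (K : hilbertType R).
Variable j : {linear U -> K}.
Hypothesis j_dense : forall k e, 0 < e -> exists u, `|k - j u| < e.

(** Density is used in one variable at a time: the difference of the two sides is sesquilinear and
    bounded, hence Lipschitz in each variable. *)
Lemma dense_inner_extension (V W : {linear K -> K}) (c : R[i]) :
  (forall k, `|V k| <= `|k|) -> (forall k, `|W k| <= `|k|) ->
  (forall u v, inner (V (j u)) (W (j v)) = c * inner (j u) (j v)) ->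
  forall k l, inner (V k) (W l) = c * inner k l.
Proof.
move=> Vle Wle VW.
have bound k l : `|inner (V k) (W l) - c * inner k l| <=
    (1 + `|c|) * (`|k| * `|l|).
  apply: le_trans (ler_normB _ _) _; rewrite mulrDl mul1r normrM lerD //.
    by apply: le_trans (inner_CauchySchwarz _ _) _; rewrite ler_pM.
  by rewrite ler_wpM2l // inner_CauchySchwarz.
have step1 v k : inner (V k) (W (j v)) - c * inner k (j v) = 0.
  apply: (dense_eq0 j_dense (M := (1 + `|c|) * `|j v|)
    (f := fun k => inner (V k) (W (j v)) - c * inner k (j v))) => [|u|x y].
  - by rewrite mulr_ge0 ?addr_ge0.
  - by rewrite VW subrr.
  - rewrite mulrAC -mulrA; have := bound (x - y) (j v); congr (`|_| <= _).
    by rewrite raddfB /= !linearBl /=; ring.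
move=> k l; apply/eqP; rewrite -subr_eq0; apply/eqP.
apply: (dense_eq0 j_dense (M := (1 + `|c|) * `|k|)
    (f := fun l => inner (V k) (W l) - c * inner k l)) => [|u|x y].
- by rewrite mulr_ge0 ?addr_ge0.
- exact: step1.
- rewrite -mulrA; have := bound k (x - y); congr (`|_| <= _).
  by rewrite raddfB /= !linearBr /=; ring.
Qed.

End HilbertDense.

(** * Construction of the dilation *)

Section Dilation.
Variables (R : realType) (H : hilbertType R) (n : nat).
Variable T : 'I_n -> {linear H -> H}.

Lemma dissipative_dilation : dissipative T ->
  exists (K : hilbertType R) (iota : {linear H -> K}) (P : K -> K)
         (V : 'I_n -> {linear K -> K}),
    [/\ isometry inner inner iota,
        orthogonal_projection (range iota) P,
        forall j : 'I_n, isometry inner inner (V j),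
        orthogonal_ranges V &
        forall s : seq 'I_n, s != [::] ->
          forall x : H,
            iota (word_op T s x) = 2 *: P (word_op V s (iota x))].
Proof.
move=> Td; have [K [j [jq jd]]] := semi_inner_completion (fock_semi Td).
have jE f g : inner (j f) (j g) = fock_form T f g := jq f g.
pose iota : {linear H -> K} := j \o @vacuum R H n.
have iotaE x y : inner (iota x) (iota y) = inner x y.
  by rewrite /iota /= jE fock_form_vacuum fock_proj_vacuum.
have iotaN := norm_isometry iotaE.
have projE f y : inner (j f) (iota y) = inner (fock_proj T f) y.
  by rewrite /iota /= jE fock_form_vacuum.
(* For [p = fock_proj T f], one has [|p|^2 = <j f, iota p> <= |j f| |p|], and [|p|] cancels. *)
have proj_le f : `|fock_proj T f| <= `|j f|.
  have [->|p0] := eqVneq `|fock_proj T f| 0; first exact: normr_ge0.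
  have pp : 0 < `|fock_proj T f| by rewrite lt_def p0 normr_ge0.
  rewrite -(ler_pM2r pp) -expr2 inner_norm -projE.
  have := inner_CauchySchwarz (j f) (iota (fock_proj T f)).
  rewrite iotaN ger0_norm // projE -inner_norm; exact: exprn_ge0.
(* [Phi] is the adjoint of the isometry [iota], so [iota \o Phi] is the projection onto its
   range. *)
have [Phi [Phij Phile]] := dense_extension jd proj_le.
have PhiE f : Phi (j f) = fock_proj T f := Phij f.
have creation_iso (i : 'I_n) (f : fock H n) : `|j (creation T i f)| <= `|j f|.
  rewrite -ler_sqr ?nnegrE // !inner_norm !jE.
  by rewrite fock_form_creation eqxx mul1r.
have /choice[V VP] : forall i, exists V : {linear K -> K},
    (forall f, V (j f) = j (creation T i f)) /\ (forall k, `|V k| <= `|k|).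
  move=> i.
  exact: (dense_extension jd (phi := j \o creation T i) (creation_iso i)).
have VE i f : V i (j f) = j (creation T i f) by have [] := VP i.
have Vle i k : `|V i k| <= `|k| by have [_] := VP i.
(* The cases [i = l] and [i != l] give the isometries and the orthogonality of their ranges. *)
have VVE i l k k' : inner (V i k) (V l k') = (i == l)%:R * inner k k'.
  apply: (dense_inner_extension jd (Vle i) (Vle l)) => f g.
  by rewrite !VE !jE fock_form_creation.
have wordE s f : word_op V s (j f) = j (word_op (creation T) s f).
  by elim: s => //= i s ->; rewrite VE.
exists K, iota, (fun k => iota (Phi k)), V; split => //.
- move=> k; split; first by exists (Phi k).
  move=> _ [y _ <-].
  apply: (dense_eq0 jd (M := 2 * `|y|) 
    (f := fun k => inner (k - iota (Phi k)) (iota y))) => [|f|x z].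
  + by rewrite mulr_ge0.
  + by rewrite linearBl /= projE iotaE PhiE subrr.
  + rewrite (_ : _ - _ = inner (x - z - iota (Phi (x - z))) (iota y)).
      2: by rewrite (raddfB Phi) (raddfB iota) /= !linearBl /=; ring.
    apply: le_trans (inner_CauchySchwarz _ _) _; rewrite iotaN mulrAC.
    rewrite ler_wpM2r // (le_trans (ler_normB _ _)) //.
    by rewrite mulrDl mul1r lerD // iotaN.
- by move=> i k k'; have := VVE i i k k'; rewrite eqxx mul1r.
- by move=> i l il k k'; have := VVE i l k k'; rewrite (negbTE il) mul0r.
- move=> s s0 x; rewrite (wordE s (vacuum n x)) PhiE fock_proj_word_op //.
  by rewrite (linearZ_LR iota) /= scalerA divff ?scale1r // pnatr_eq0.
Qed.

End Dilation.

(** * Necessity of the numerical radius bound *)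

Section IsometricDilation.
Variables (R : realType) (H K : hilbertType R) (n : nat).
Variables (T : 'I_n -> {linear H -> H}) (iota : {linear H -> K}).
Variables (P : K -> K) (V : 'I_n -> {linear K -> K}).
Local Notation word := (seq 'I_n).
Hypothesis iota_iso : isometry inner inner iota.
Hypothesis P_proj : orthogonal_projection (range iota) P.
Hypothesis V_iso : forall j, isometry inner inner (V j).
Hypothesis V_orth : orthogonal_ranges V.
Hypothesis dilation : forall s : word, s != [::] -> forall x,
  iota (word_op T s x) = 2 *: P (word_op V s (iota x)).

(** [word_op] is a bare function; the witness gives access to the rules for linear maps. *)
Lemma word_op_linear (L : hilbertType R) (W : 'I_n -> {linear L -> L}) s :
  exists F : {linear L -> L}, word_op W s =1 F.
Proof.
elim: s => [|j s [F FE]]; first by exists idfun.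
by exists (W j \o F) => x /=; rewrite FE.
Qed.

Lemma word_op_rcons (X : Type) (W : 'I_n -> X -> X) s j x :
  word_op W (rcons s j) x = word_op W s (W j x).
Proof. by elim: s => //= i s ->. Qed.

(** As [w - P w] is orthogonal to the range of [iota], the projection disappears from the inner
    product. *)
Lemma inner_dilation s x y : s != [::] ->
  inner (word_op V s (iota x)) (iota y) = 2^-1 * inner (word_op T s x) y.
Proof.
move=> s0; set w := word_op V s _.
have Pw : inner w (iota y) = inner (P w) (iota y).
  apply/eqP; rewrite -subr_eq0; apply/eqP.
  have [_ /(_ (iota y)) <-] := P_proj w; last by exists y.
  by rewrite linearBl.
have -> : inner (word_op T s x) y = inner (iota (word_op T s x)) (iota y).
  by rewrite iota_iso.
rewrite Pw dilation // innerZl mulrA.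
by rewrite mulVf ?mul1r // pnatr_eq0.
Qed.

(* Horner form of [sum_a V_a (iota (defect T f a))]. *)
Fixpoint fock_vector N (f : word -> H) : K :=
  if N is N'.+1 then
    iota (defect T f [::]) + \sum_i V i (fock_vector N' (fun a => f (i :: a)))
  else 0.

Lemma bounded_support_cons N (f : word -> H) i :
  bounded_support N.+1 f -> bounded_support N (fun a => f (i :: a)).
Proof. by move=> f0 a Na; exact: f0. Qed.

(** The sum telescopes: by induction the branch of first letter [i] contributes half of
    [T_s T_i f(g_i)], and together the branches restore what the defect subtracts from [f [::]]. *)
Lemma inner_word_fock_vector N f s y : bounded_support N f -> s != [::] ->
  inner (word_op V s (fock_vector N f)) (iota y) =
  2^-1 * inner (word_op T s (f [::])) y.
Proof.
elim: N f s => [|N IHN] f s f0 s0.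
  have [F FE] := word_op_linear V s; have [G GE] := word_op_linear T s.
  by rewrite FE GE f0 // !linear0 !linear0l mulr0.
have [F FE] := word_op_linear V s; have [G GE] := word_op_linear T s.
rewrite FE /= raddfD raddf_sum /= linearDl /= inner_suml -FE inner_dilation //.
rewrite (eq_bigr (fun i => 2^-1 * inner (word_op T s (T i (f [:: i]))) y)).
  rewrite -mulr_sumr -mulrDr -inner_suml -linearDl /=; congr (_ * inner _ y).
  rewrite GE (eq_bigr (fun i => G (T i (f [:: i])))) => [|i _]; last exact: GE.
  by rewrite -raddf_sum -raddfD /= GE /defect /backward subrK.
move=> i _; rewrite -FE -word_op_rcons IHN; last by case: (s).
- by rewrite word_op_rcons.
- exact: bounded_support_cons.
Qed.

(** Orthogonal ranges separate the branches, each treated by induction. Their cross terms with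
    [iota d] follow from [inner_word_fock_vector] for one-letter words and complete [<d, d>] to the
    summand at the empty word. *)
Lemma norm_fock_vector N f : bounded_support N f ->
  inner (fock_vector N f) (fock_vector N f) =
  \sum_(a <- words n N) fock_term T f f a.
Proof.
elim: N f => [|N IHN] f f0; first by rewrite /= linear0l big_nil.
rewrite big_wordsS /=; set d := defect T f [::].
set w := fun i => fock_vector N (fun a => f (i :: a)).
have Vd i : inner (V i (w i)) (iota d) = 2^-1 * inner (T i (f [:: i])) d.
  have fi0 := bounded_support_cons i f0.
  by rewrite -(inner_word_fock_vector (s := [:: i]) _ fi0).
have vd : inner (\sum_i V i (w i)) (iota d) =
    2^-1 * inner (backward T f [::]) d.
  by rewrite inner_suml (eq_bigr _ (fun i _ => Vd i)) -mulr_sumr -inner_suml.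
have vv : inner (\sum_i V i (w i)) (\sum_i V i (w i)) =
    \sum_i \sum_(a <- words n N) fock_term T f f (i :: a).
  rewrite inner_suml; apply: eq_bigr => i _; rewrite inner_sumr (bigD1 i) //=.
  rewrite big1 ?addr0 => [|l li]; last by rewrite V_orth // eq_sym.
  have -> : inner (V i (w i)) (V i (w i)) = inner (w i) (w i) by exact: V_iso.
  exact: (IHN _ (bounded_support_cons i f0)).
have iotaE : inner (iota d) (iota d) = inner d d by exact: iota_iso.
have fE : f [::] = d + backward T f [::] by rewrite /d /defect subrK.
have -> : fock_term T f f [::] =
    2^-1 * (inner d (d + backward T f [::]) + inner (d + backward T f [::]) d).
  by rewrite -fE.
have -> : inner (iota d + \sum_i V i (w i)) (iota d + \sum_i V i (w i)) =
    inner (iota d) (iota d) + inner (\sum_i V i (w i)) (\sum_i V i (w i)) +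
    (inner (\sum_i V i (w i)) (iota d) + (inner (\sum_i V i (w i)) (iota d))^*).
  by rewrite addrC (semi_formD (inner_semi K)) /= [X in X + _]addrC.
rewrite vv vd iotaE; move: d fE {Vd vd vv iotaE} => d fE.
rewrite linearDl linearDr /= rmorphM fmorphV rmorph_nat /= -innerC.
by field.
Qed.

(** The squared norm of [fock_vector N f] is nonnegative. The equation for [z] allows the value of
    the sum to be prescribed, as is done below for a rotated family. *)
Lemma Re_dilation_dissipative N f z : bounded_support N f ->
  z = \sum_(a <- words n N) inner (backward T f a) (f a) ->
  z + z^* <= 2 * \sum_(a <- words n N) inner (f a) (f a).
Proof.
move=> f0 ->; have := dnorm_ge0 (@inner R K) (fock_vector N f).
rewrite norm_fock_vector // -(pmulr_rge0 _ (ltr0n _ 2)).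
by rewrite sum_fock_term subr_ge0.
Qed.

Lemma dilation_dissipative : dissipative T.
Proof.
move=> N f f0; set z := \sum_(a <- _) _; set s := \sum_(a <- _) _.
have [->|z0] := eqVneq z 0.
  by rewrite normr0 sumr_ge0 // => a _; exact: dnorm_ge0.
(* This [u] turns the sum for the rotated family, [u * z], into [|z|]. *)
pose u := `|z| / z; have u1 : `|u| = 1.
  by rewrite normrM normr_id normfV divff // normr_eq0.
pose g a := u ^+ size a *: f a.
have g0 : bounded_support N g by move=> a Na; rewrite /g f0 // scaler0.
have normu k : u ^+ k * (u ^+ k)^* = 1.
  by rewrite -normCK normrX u1 !expr1n.
have gs : \sum_(a <- words n N) inner (g a) (g a) = s.
  by apply: eq_bigr => a _; rewrite /g innerZl innerZr mulrA normu mul1r.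
have := @Re_dilation_dissipative _ _ `|z| g0; rewrite gs.
rewrite (conj_Creal (normr_real z)) -mulr2n -(mulr_natl `|z| 2).
rewrite ler_pM2l ?ltr0n //; apply.
rewrite -[LHS](divfK z0) -/u mulr_sumr; apply: eq_bigr => a _.
(* [backward] reads words one letter longer, which leaves one factor [u] after cancellation. *)
have -> : backward T g a = u ^+ (size a).+1 *: backward T f a.
  rewrite /backward scaler_sumr; apply: eq_bigr => j _.
  by rewrite /g size_rcons linearZ.
by rewrite /g innerZl innerZr exprS [RHS]mulrA -[u * _ * _]mulrA normu mulr1.
Qed.

End IsometricDilation.

(** * The joint numerical radius *)

#[local] Existing Instance totally_filter.

(** * Unordered sums and their finite partial sums *)

Section FiniteSums.
Variables (I : choiceType).

Lemma partial_sumE (V : zmodType) (x : I -> V) (A : {fset I}) :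
  partial_sum x A = \sum_(i <- A) x i.
Proof. by rewrite big_seq_fsetE. Qed.

Lemma big_fset_seq (V : zmodType) (x : I -> V) (r : seq I) :
  uniq r -> \sum_(i <- [fset i in r]%fset) x i = \sum_(i <- r) x i.
Proof.
move=> ur; apply: perm_big; apply: uniq_perm; rewrite ?fset_uniq //.
by move=> i; rewrite inE.
Qed.

Lemma big_fset_supp (V : zmodType) (x : I -> V) (r : seq I) (A : {fset I}) :
  uniq r -> {subset r <= A} -> (forall i, i \notin r -> x i = 0) ->
  \sum_(i <- A) x i = \sum_(i <- r) x i.
Proof.
move=> ur rA x0; rewrite (bigID (mem r)) /= addrC big1 ?add0r => [|i /x0 //].
rewrite -big_filter; apply: perm_big; apply: uniq_perm => //.
  by rewrite filter_uniq ?fset_uniq.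
move=> i; rewrite mem_filter; case: (boolP (i \in r)) => //= /rA.
by move=> ->.
Qed.

Lemma sum_finite_support (K : numFieldType) (x : I -> K^o) (r : seq I) :
  uniq r -> (forall i, i \notin r -> x i = 0) ->
  sum x = \sum_(i <- r) x i.
Proof.
move=> ur x0; apply: lim_near_cst; first exact: norm_hausdorff.
exists [fset i in r]%fset => //= A /= /fsubsetP rA.
rewrite partial_sumE; apply: big_fset_supp => // i ir.
by apply: rA; rewrite inE.
Qed.

Lemma esum_finite_support (R : realType) (x : I -> R) (r : seq I) :
  uniq r -> (forall i, i \notin r -> x i = 0) -> (forall i, 0 <= x i) ->
  (\esum_(i in [set: I]) (x i)%:E)%E = (\sum_(i <- r) x i)%:E.
Proof.
move=> ur x0 xge0.
rewrite (_ : (\esum_(i in [set: I]) (x i)%:E)%E =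
  (\esum_(i in [set` r]) (x i)%:E)%E); last first.
  rewrite [RHS]esum_mkcond; apply: eq_esum => i _.
  by case: ifPn => //; rewrite mem_setE => /x0 ->.
rewrite esum_fset // => [|i _]; last by rewrite lee_fin.
by rewrite -fsbig_seq //= sumEFin.
Qed.

Lemma le_esum_seq (R : realType) (x : I -> R) (r : seq I) :
  uniq r -> ((\sum_(i <- r) x i)%:E <= \esum_(i in [set: I]) (x i)%:E)%E.
Proof.
move=> ur; apply: esum_ge; exists [set` r]; first by split.
by rewrite -fsbig_seq //= sumEFin.
Qed.

(** The increasing sets [N k] exhaust [I], so they are cofinal among the finite subsets. *)
Lemma cvg_sum_seq (K : numFieldType) (x : I -> K^o) (e : K) (N : nat -> seq I) :
  0 < e -> cvg (partial_sum x @ totally) ->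
  (forall k, uniq (N k)) -> (forall k l, (k <= l)%N -> {subset N k <= N l}) ->
  (forall i, exists k, i \in N k) ->
  exists k, `|sum x - \sum_(i <- N k) x i| < e.
Proof.
move=> e0 xcvg uN monoN exN.
have /cvgrPdist_lt /(_ _ e0)[A _ AP] := xcvg.
have [k Ak] : exists k, {subset A <= N k}.
  have /choice[f fP] := exN.
  exists (\max_(i <- A) f i)%N => i iA; apply: monoN (fP i).
  by rewrite (big_rem i) //= leq_maxl.
exists k; rewrite -(@big_fset_seq _ x) // -partial_sumE; apply: AP => /=.
by apply/fsubsetP => i /Ak iN; rewrite inE.
Qed.

End FiniteSums.

(** * The numerical radius bound as dissipativity *)

Section JointRadius.
Variables (R : realType) (H : hilbertType R) (n : nat).
Variable T : 'I_n -> {linear H -> H}.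
Local Notation C := R[i].
Local Notation word := (seq 'I_n).

Lemma Re_sqr_norm (x : H) : (complex.Re `|x| ^+ 2)%:C = inner x x.
Proof.
by rewrite -inner_norm -[in RHS](RRe_real (normr_real x)) rmorphXn.
Qed.

Lemma sum_sqr_normE (r : seq word) (h : word -> H) :
  (\sum_(a <- r) complex.Re `|h a| ^+ 2)%:C = \sum_(a <- r) inner (h a) (h a).
Proof. by rewrite rmorph_sum; apply: eq_bigr => a _; exact: Re_sqr_norm. Qed.

Lemma notin_words N (a : word) : (a \notin words n N) = (N <= size a)%N.
Proof. by rewrite mem_words -leqNgt. Qed.

(** Reversal turns prepending [j] into appending it; the conjugate comes from the order of the
    factors in the inner product. *)
Lemma form_rev (f : word -> H) a :
  \sum_j inner (f (rev a)) (T j (f (rev (j :: a)))) =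
  (inner (backward T f (rev a)) (f (rev a)))^*.
Proof.
rewrite -innerC inner_sumr; apply: eq_bigr => j _.
by rewrite rev_cons.
Qed.

Lemma joint_radius_dissipative :
  (joint_numerical_radius T <= 1)%E -> dissipative T.
Proof.
move=> w1 N f f0; set z := \sum_(a <- _) _; set s := \sum_(a <- _) _.
have s0 : 0 <= s by apply: sumr_ge0 => a _; exact: dnorm_ge0.
have [s00|sn0] := eqVneq s 0.
  rewrite s00 (_ : z = 0) ?normr0 //; apply: big1_seq => a /= aN.
  suff -> : f a = 0 by rewrite linear0r.
  apply/eqP; rewrite -(dnorm_eq0 (@inner R H)); move/eqP: s00.
  rewrite psumr_eq0 => [|b _]; last exact: dnorm_ge0.
  by move=> /allP /(_ a aN).
have sp : 0 < s by rewrite lt_def sn0.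
(* Normalises the reversed family to square sum 1. *)
pose c := sqrtC s^-1.
have c0 : 0 <= c by rewrite sqrtC_ge0 invr_ge0.
have cc : c * c^* = s^-1 by rewrite conj_Creal ?ger0_real // -expr2 sqrtCK.
pose h a := c *: f (rev a).
have h0 a : a \notin words n N -> h a = 0.
  by rewrite notin_words /h => Na; rewrite f0 ?scaler0 // size_rev.
have hh : \sum_(a <- words n N) inner (h a) (h a) = 1.
  rewrite (eq_bigr (fun a => s^-1 * inner (f (rev a)) (f (rev a)))) => [|a _].
    rewrite -mulr_sumr (big_words_rev N (fun a => inner (f a) (f a))).
    by rewrite mulVf.
  by rewrite /h innerZl innerZr mulrA cc.
have hunit : unit_family h.
  rewrite /unit_family /= (esum_finite_support (uniq_words n N)).
  - congr (_%:E); apply: complexI.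
    by rewrite sum_sqr_normE hh.
  - by move=> a /h0 ->; rewrite normr0 expr0n.
  - by move=> a; rewrite exprn_ge0 // -ler0c RRe_real ?normr_real.
have hform : joint_form T h = s^-1 * z^*.
  rewrite /joint_form (sum_finite_support (uniq_words n N)); last first.
    by move=> a /h0 ha; apply: big1 => j _; rewrite ha linear0l.
  rewrite /z rmorph_sum mulr_sumr.
  rewrite -(big_words_rev N (fun a => s^-1 * (inner (backward T f a) (f a))^*)).
  apply: eq_bigr => a _; rewrite -form_rev mulr_sumr; apply: eq_bigr => j _.
  by rewrite /h linearZ /= innerZl innerZr mulrA cc.
have : ((complex.Re `|joint_form T h|)%:E <= 1)%E.
  by apply: le_trans w1; apply: ereal_sup_ubound; exists h.
rewrite lee_fin -lecR RRe_real ?normr_real // hform normrM norm_conjC.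
by rewrite normfV (ger0_norm s0) mulrC ler_pdivrMr // mul1r.
Qed.

(** Summands at words shorter than [N] read entries of length up to [N], so [h] is truncated one
    level higher, whence [N.+1] on the right. [backward] of the truncation is supported below length
    [N]. *)
Lemma partial_joint_form_le N (h : word -> H) : dissipative T ->
  `|\sum_(a <- words n N) \sum_j inner (h a) (T j (h (j :: a)))| <=
  \sum_(a <- words n N.+1) inner (h a) (h a).
Proof.
move=> Td; pose f a := if (size a < N.+1)%N then h (rev a) else 0.
have f0 : bounded_support N.+1 f by move=> a Na; rewrite /f ltnNge Na.
have bf0 : bounded_support N (backward T f).
  move=> a Na; apply: big1 => j _.
  by rewrite f0 ?linear0 // size_rcons.
have <- : \sum_(a <- words n N.+1) inner (f a) (f a) =
    \sum_(a <- words n N.+1) inner (h a) (h a).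
  rewrite -[RHS]big_words_rev; apply: eq_big_seq => a.
  by rewrite mem_words /f => ->.
have -> : \sum_(a <- words n N) \sum_j inner (h a) (T j (h (j :: a))) =
    (\sum_(a <- words n N) inner (backward T f a) (f a))^*.
  rewrite rmorph_sum /= -[RHS]big_words_rev; apply: eq_big_seq => a.
  rewrite mem_words => aN; rewrite -form_rev; apply: eq_bigr => j _.
  by rewrite /f !size_rev /= !revK ltnS (ltnW aN) ltnS aN.
have := Td _ _ f0; rewrite (big_words_widen (leqnSn N)) ?norm_conjC //.
by move=> a Na; rewrite bf0 // linear0l.
Qed.

Lemma dissipative_joint_radius :
  dissipative T -> (joint_numerical_radius T <= 1)%E.
Proof.
move=> Td; apply: ge_ereal_sup => _ [h hunit <-].
rewrite lee_fin -lecR RRe_real ?normr_real //.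
pose x : word -> C^o := fun a => \sum_(j < n) inner (h a) (T j (h (j :: a))).
rewrite -[joint_form T h]/(sum x).
have [xcvg|xncvg] := pselect (cvg (partial_sum x @ totally)); last first.
  (* A divergent [sum] is the default point of [C^o], which is 0. *)
  by rewrite /sum dvgP // normr0.
have partial_le N : `|\sum_(a <- words n N) x a| <= 1.
  apply: le_trans (partial_joint_form_le N h Td) _.
  rewrite -sum_sqr_normE -[1]/(1%:C) lecR -lee_fin -hunit.
  exact: le_esum_seq (uniq_words n N.+1).
(* Otherwise some partial sum is closer to [sum x] than the excess [|sum x| - 1], against
   [partial_le]. *)
rewrite real_leNgt ?normr_real // ?real1 //; apply/negP => lt1.
have [|k l kl|a|N] := @cvg_sum_seq _ _ x (`|sum x| - 1) (words n) _ xcvg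
  (@uniq_words n).
- by rewrite subr_gt0.
- by move=> a; rewrite !mem_words => /leq_trans; apply.
- by exists (size a).+1; rewrite mem_words.
have : `|sum x| - 1 <= `|sum x - \sum_(a <- words n N) x a|.
  by apply: le_trans (lerB_dist _ _); rewrite lerD2l lerN2; exact: partial_le.
by move=> /le_lt_trans /[apply]; rewrite ltxx.
Qed.

End JointRadius.

(** Both conditions are linked through [dissipative T]. *)
Theorem theorem1p8 (R : realType) (H : hilbertType R) (n : nat)
    (T : 'I_n -> {linear H -> H}) (n_gt0 : (0 < n)%N)
    (T_bounded : forall j : 'I_n, bounded_near (T j) (nbhs (0 : H))) :
  (joint_numerical_radius T <= 1)%E
  <->
  exists (K : hilbertType R) (iota : {linear H -> K}) (P : K -> K)
         (V : 'I_n -> {linear K -> K}),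
    [/\ isometry inner inner iota,
        orthogonal_projection (range iota) P,
        forall j : 'I_n, isometry inner inner (V j),
        orthogonal_ranges V &
        forall s : seq 'I_n, s != [::] ->
          forall x : H,
            iota (word_op T s x) = 2 *: P (word_op V s (iota x))].
Proof.
split=> [/joint_radius_dissipative|]; first exact: dissipative_dilation.
move=> [K [iota [P [V [iota_iso P_proj V_iso V_orth VT]]]]].
apply: dissipative_joint_radius.
exact: dilation_dissipative iota_iso P_proj V_iso V_orth VT.
Qed.
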